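(* Let $0<a<b$ be real numbers, let $s\in(0,1]$, and let $q>1$ and $p$ satisfy $\frac1p+\frac1q=1$. Then $$\left|L_s^s(a,b)+\frac{(s-1)G^2(a,b)L_{s-2}^{s-2}(a,b)-A^s(a,b)}{2}\right|$$ $$\le \frac{L_p(a,b)}{\left(2^{2q+s}(s+1)\right)^{1/q}}\left\{\left(\left(sb^{s-1}\right)^q+\left(2^{s+1}-1\right)\left(sa^{s-1}\right)^q\right)^{1/q}+\left(\left(sa^{s-1}\right)^q+\left(2^{s+1}-1\right)\left(sb^{s-1}\right)^q\right)^{1/q}\right\},$$ where for $s=1$ the term $(s-1)G^2(a,b)L_{s-2}^{s-2}(a,b)$ is read as $0$.
   Context: For $0<u<v$: $A(u,v)=\frac{u+v}{2}$ (arithmetic mean), $G(u,v)=\sqrt{uv}$ (geometric mean), and for real $r\neq -1,0$, $L_r(u,v)=\left(\frac{v^{r+1}-u^{r+1}}{(r+1)(v-u)}\right)^{1/r}$ (generalized logarithmic mean). Exponents on means denote powers of their values: $A^r(u,v)=(A(u,v))^r$, $G^2(u,v)=(G(u,v))^2=uv$, and $L_r^r(u,v)=(L_r(u,v))^r=\frac{v^{r+1}-u^{r+1}}{(r+1)(v-u)}$. *)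

(* Defs.v *)
From Stdlib Require Import Reals.
Local Open Scope R_scope.

(* The means are meant for arguments 0 < u < v; every base to which the real
   power [Rpower] is applied is then positive (for x <= 0 the value of
   [Rpower x y] is a default one). *)

Definition arith_mean (u v : R) : R := (u + v) / 2.

Definition geom_mean (u v : R) : R := sqrt (u * v).

(* Meaningful for r <> -1 and r <> 0. *)
Definition gen_log_mean (r u v : R) : R :=
  Rpower ((Rpower v (r + 1) - Rpower u (r + 1)) / ((r + 1) * (v - u))) (1 / r).

(* Main.v *)
Require Import Defs.
From Stdlib Require Import Reals Lra.
From Coquelicot Require Import Coquelicot.
Local Open Scope R_scope.

(** Write [f x = x^s] and [m = (a + b) / 2].  Integrating by parts over [a, m]
    and over [m, b], each parametrised by [0, 1], turns the expression inside
    the absolute value into one quarter of [H a b + H b a], where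
<<
      H c d = \int_0^1 ((1 - t) d + t c) f'((1 - t/2) c + (t/2) d) dt
>>
    has the closed form [half_integral s c d] ([is_RInt_half],
    [means_eq_half_integrals]).  The segment from [b] down to [m] is run
    backwards, which is what makes both pieces instances of the same [H].
    The integrand is positive, so the absolute value disappears and only an
    upper bound for [H] is needed.

    Hölder's inequality separates the two factors of the integrand.  The
    [p]-th power of the affine weight integrates exactly to the [p]-th power of
    [gen_log_mean p c d].  For the other factor, [f' ^ q] is a constant times
    [x^((s - 1) q)], a power with exponent at most 0, hence convex: along the
    segment it lies below [(1 - t/2) P + (t/2) Q] with [P = f'(c)^q] and
    [Q = f'(d)^q], and this integrates to [(3 P + Q) / 4].  The theorem has the
    weights of the weaker [s]-convexity bound
    [(1 - t/2)^s P + (t/2)^s Q], whose integral is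
    [((2^(s+1) - 1) P + Q) / (2^s (s + 1))]; [convex_weights_le] compares the
    two results.  Going through ordinary convexity keeps every integrand smooth
    on the closed interval, whereas for [s < 1] the function [(t/2)^s] is not
    differentiable at [t = 0]. *)

(** * Inequalities for real powers *)

Lemma Rpower_pos (x y : R) : 0 < Rpower x y.
Proof. apply exp_pos. Qed.

Lemma Rpower_S (x y : R) : 0 < x -> Rpower x (y + 1) = Rpower x y * x.
Proof. intros Hx; now rewrite Rpower_plus, Rpower_1. Qed.

Lemma power_quotient_pos (e u v : R) :
  0 < u -> 0 < v -> u <> v -> e <> 0 ->
  0 < (Rpower v e - Rpower u e) / (e * (v - u)).
Proof.
  (* By symmetry in [u] and [v] it suffices to treat [u < v]. *)
  assert (ordered : forall x y, 0 < x < y -> e <> 0 ->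
            0 < (Rpower y e - Rpower x e) / (e * (y - x))).
  { intros x y Hxy He.
    destruct (Rdichotomy e 0 He) as [Hneg | Hpos].
    - replace (_ / _) with ((Rpower x e - Rpower y e) / (- e * (y - x)))
        by (field; lra).
      apply Rdiv_lt_0_compat; [apply Rlt_0_minus | apply Rmult_lt_0_compat; lra].
      replace e with (- - e) by ring; rewrite !(Rpower_Ropp _ (- e)).
      apply Rinv_lt_contravar.
      + apply Rmult_lt_0_compat; apply Rpower_pos.
      + apply Rlt_Rpower_l; lra.
    - apply Rdiv_lt_0_compat; [| apply Rmult_lt_0_compat; lra].
      apply Rlt_0_minus, Rlt_Rpower_l; lra. }
  intros Hu Hv Huv He.
  destruct (Rdichotomy u v Huv) as [H | H].
  - apply ordered; lra.
  - replace (_ / _) with ((Rpower u e - Rpower v e) / (e * (u - v))) by (field; lra).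
    apply ordered; lra.
Qed.

(** The exponential lies above its tangent line at the weighted mean
    [l * ln x + m * ln y]; averaging the two tangent inequalities gives the
    claim. *)
Lemma weighted_am_gm (l m x y : R) :
  0 <= l -> 0 <= m -> l + m = 1 -> 0 < x -> 0 < y ->
  Rpower x l * Rpower y m <= l * x + m * y.
Proof.
  intros Hl Hm Hlm Hx Hy; unfold Rpower; rewrite <- exp_plus.
  set (z := l * ln x + m * ln y).
  assert (tangent : forall w, 0 < w -> exp z * (1 + (ln w - z)) <= w).
  { intros w Hw.
    replace w with (exp z * exp (ln w - z)) at 2.
    - apply Rmult_le_compat_l; [left; apply exp_pos | apply exp_ineq1_le].
    - rewrite <- exp_plus; replace (z + (ln w - z)) with (ln w) by ring.
      now apply exp_ln. }
  pose proof (Rmult_le_compat_l l _ _ Hl (tangent x Hx)) as Tx.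
  pose proof (Rmult_le_compat_l m _ _ Hm (tangent y Hy)) as Ty.
  replace (exp z) with
    (l * (exp z * (1 + (ln x - z))) + m * (exp z * (1 + (ln y - z)))).
  - lra.
  - unfold z; replace m with (1 - l) by lra; ring.
Qed.

(** Bernoulli's inequality for nonpositive exponents, from
    [x^r >= 1 + r ln x] and [ln x <= x - 1]; multiplication by [r] reverses the
    latter. *)
Lemma Rpower_bernoulli_neg (r x : R) :
  r <= 0 -> 0 < x -> 1 + r * (x - 1) <= Rpower x r.
Proof.
  intros Hr Hx; unfold Rpower.
  pose proof (exp_ineq1_le (r * ln x)).
  pose proof (exp_ineq1_le (ln x)) as Hln; rewrite exp_ln in Hln by assumption.
  pose proof (Rmult_le_compat_neg_l r (ln x) (x - 1) Hr); lra.
Qed.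

(** Bernoulli's inequality, rescaled, says that the graph lies above its tangent
    at the mean point [z]; the first-order terms cancel in the average. *)
Lemma Rpower_neg_convex (r l m x y : R) :
  r <= 0 -> 0 <= l -> 0 <= m -> l + m = 1 -> 0 < x -> 0 < y ->
  Rpower (l * x + m * y) r <= l * Rpower x r + m * Rpower y r.
Proof.
  intros Hr Hl Hm Hlm Hx Hy.
  set (z := l * x + m * y).
  assert (Hz : 0 < z).
  { unfold z; destruct (Rle_lt_or_eq_dec 0 l Hl) as [Hl'|<-].
    - pose proof (Rmult_lt_0_compat l x Hl' Hx).
      pose proof (Rmult_le_pos m y Hm (Rlt_le _ _ Hy)); lra.
    - replace m with 1 by lra; lra. }
  assert (tangent : forall w, 0 < w ->
            Rpower z r * (1 + r * (w / z - 1)) <= Rpower w r).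
  { intros w Hw.
    replace (Rpower w r) with (Rpower z r * Rpower (w / z) r).
    - apply Rmult_le_compat_l; [left; apply Rpower_pos |].
      apply Rpower_bernoulli_neg; [assumption | now apply Rdiv_lt_0_compat].
    - rewrite Rpower_mult_distr by (try apply Rdiv_lt_0_compat; assumption).
      f_equal; field; lra. }
  pose proof (Rmult_le_compat_l l _ _ Hl (tangent x Hx)) as Tx.
  pose proof (Rmult_le_compat_l m _ _ Hm (tangent y Hy)) as Ty.
  replace (Rpower z r) with
    (l * (Rpower z r * (1 + r * (x / z - 1)))
     + m * (Rpower z r * (1 + r * (y / z - 1)))) at 1.
  - lra.
  - transitivity (Rpower z r * ((l + m) + r * ((l * x + m * y) / z - (l + m)))).
    + field; lra.
    + fold z; rewrite Hlm; field; lra.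
Qed.

(** It suffices to compare the coefficients of [P] and of [Q].  With [k = 2^s],
    that of [Q] needs [k (s + 1) <= 4], which follows from [k <= 1 + s <= 2];
    that of [P] needs [k (5 - 3 s) >= 4], which follows from
    [1 / k = (1/2)^s <= 1 - s/2 <= (5 - 3 s) / 4].  Both estimates of powers
    are instances of [weighted_am_gm]. *)
Lemma convex_weights_le (s P Q : R) :
  0 < s <= 1 -> 0 < P -> 0 < Q ->
  3 / 4 * P + 1 / 4 * Q
  <= (Q + (Rpower 2 (s + 1) - 1) * P) / (Rpower 2 s * (s + 1)).
Proof.
  intros Hs HP HQ.
  pose proof (Rpower_pos 2 s) as H2s.
  pose proof (weighted_am_gm s (1 - s) 2 1 ltac:(lra) ltac:(lra) ltac:(lra)
                ltac:(lra) ltac:(lra)) as upper.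
  pose proof (weighted_am_gm s (1 - s) (/ 2) 1 ltac:(lra) ltac:(lra) ltac:(lra)
                ltac:(lra) ltac:(lra)) as lower.
  assert (R1 : Rpower 1 (1 - s) = 1)
    by (unfold Rpower; rewrite ln_1, Rmult_0_r; apply exp_0).
  rewrite R1 in upper, lower.
  assert (inv : Rpower 2 s * Rpower (/ 2) s = 1).
  { rewrite Rpower_mult_distr by lra.
    replace (2 * / 2) with 1 by lra.
    unfold Rpower; rewrite ln_1, Rmult_0_r; apply exp_0. }
  rewrite Rpower_S by lra.
  set (k := Rpower 2 s) in *.
  pose proof (Rmult_le_compat_l k _ _ (Rlt_le _ _ H2s) lower) as low.
  assert (HQ4 : k * (s + 1) <= 4).
  { apply Rle_trans with (2 * 2); [apply Rmult_le_compat |]; lra. }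
  assert (k1 : 0 <= k * (1 - s)) by (apply Rmult_le_pos; lra).
  assert (HP4 : 3 * (k * (s + 1)) <= 4 * (k * 2 - 1)) by lra.
  apply Rmult_le_reg_r with (k * (s + 1)); [apply Rmult_lt_0_compat; lra |].
  unfold Rdiv; rewrite (Rmult_assoc (_ + _)), Rinv_l, Rmult_1_r;
    [| apply Rgt_not_eq, Rmult_lt_0_compat; lra].
  pose proof (Rmult_le_compat_r Q _ _ (Rlt_le _ _ HQ) HQ4).
  pose proof (Rmult_le_compat_r P _ _ (Rlt_le _ _ HP) HP4).
  lra.
Qed.

(** * Hölder's inequality *)

(** The usual proof by Young's inequality, with [f ^ p] and [g ^ q] normalised
    by [Fp] and [H].  Replacing the integral of [g ^ q] by that of a majorant
    [h] spares any discussion of the integrability of [g ^ q]. *)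
Lemma holder_with_majorant (f g h : R -> R) (lo hi p q FG Fp H : R) :
  lo <= hi -> 0 < p -> 0 < q -> 1 / p + 1 / q = 1 ->
  (forall x, lo < x < hi -> 0 < f x) ->
  (forall x, lo < x < hi -> 0 < g x) ->
  (forall x, lo < x < hi -> Rpower (g x) q <= h x) ->
  is_RInt (fun x => f x * g x) lo hi FG ->
  is_RInt (fun x => Rpower (f x) p) lo hi Fp ->
  is_RInt h lo hi H ->
  0 < Fp -> 0 < H ->
  FG <= Rpower Fp (1 / p) * Rpower H (1 / q).
Proof.
  intros Hlohi Hp Hq Hpq f_pos g_pos g_le int_fg int_f int_h HFp HH.
  set (U := Rpower Fp (1 / p)); set (V := Rpower H (1 / q)).
  assert (HU : 0 < U) by apply Rpower_pos.
  assert (HV : 0 < V) by apply Rpower_pos.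
  pose proof (Rinv_0_lt_compat _ Hp) as ip; pose proof (Rinv_0_lt_compat _ Hq) as iq.
  assert (young : forall x, lo < x < hi ->
            f x * g x <= U * V / (p * Fp) * Rpower (f x) p + U * V / (q * H) * h x).
  { intros x Hx.
    specialize (f_pos x Hx); specialize (g_pos x Hx); specialize (g_le x Hx).
    pose proof (Rpower_pos (g x) q) as gq_pos.
    assert (E : f x * g x = U * V * (Rpower (Rpower (f x) p / Fp) (1 / p)
                                    * Rpower (Rpower (g x) q / H) (1 / q))).
    { assert (root : forall y Y r, 0 < r -> 0 < y -> 0 < Y ->
                y = Rpower Y (1 / r) * Rpower (Rpower y r / Y) (1 / r)).
      { intros y Y r Hr Hy HY.
        rewrite Rpower_mult_distr;
          [| assumption | apply Rdiv_lt_0_compat; [apply Rpower_pos | assumption]].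
        replace (Y * (Rpower y r / Y)) with (Rpower y r) by (field; lra).
        rewrite Rpower_mult; replace (r * (1 / r)) with 1 by (field; lra).
        symmetry; now apply Rpower_1. }
      rewrite (root (f x) Fp p) at 1 by assumption.
      rewrite (root (g x) H q) at 1 by assumption.
      fold U V; ring. }
    rewrite E.
    apply Rle_trans with
      (U * V * (1 / p * (Rpower (f x) p / Fp) + 1 / q * (h x / H))).
    - apply Rmult_le_compat_l; [apply Rlt_le, Rmult_lt_0_compat; assumption |].
      eapply Rle_trans.
      + apply weighted_am_gm; try lra;
          apply Rdiv_lt_0_compat; assumption || apply Rpower_pos.
      + apply Rplus_le_compat_l, Rmult_le_compat_l; [lra |].
        apply Rmult_le_compat_r; [left; now apply Rinv_0_lt_compat | assumption].
    - right; field; repeat split; lra. }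
  replace (U * V) with (U * V / (p * Fp) * Fp + U * V / (q * H) * H).
  - apply (is_RInt_le _ _ lo hi _ _ Hlohi int_fg
             (is_RInt_plus _ _ _ _ _ _ (is_RInt_scal _ _ _ _ _ int_f)
                                       (is_RInt_scal _ _ _ _ _ int_h))).
    exact young.
  - transitivity (U * V * (1 / p + 1 / q)).
    + field; repeat split; lra.
    + rewrite Hpq; ring.
Qed.

(** * Integrals over a segment *)

Lemma is_derive_Rpower_comp (u : R -> R) (y t u' : R) :
  0 < u t -> is_derive u t u' ->
  is_derive (fun x => Rpower (u x) y) t (u' * (y * Rpower (u t) (y - 1))).
Proof.
  intros Hu Du.
  apply (is_derive_comp (fun z => Rpower z y) u t); [| exact Du].
  apply is_derive_Reals, derivable_pt_lim_power, Hu.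
Qed.

Lemma segment_pos (c d t : R) : 0 < c -> 0 < d -> 0 <= t <= 1 -> 0 < (1 - t) * c + t * d.
Proof.
  intros Hc Hd [H0 H1].
  destruct (Rle_lt_dec t (1 / 2)).
  - pose proof (Rmult_lt_0_compat (1 - t) c ltac:(lra) Hc).
    pose proof (Rmult_le_pos t d H0 (Rlt_le _ _ Hd)); lra.
  - pose proof (Rmult_lt_0_compat t d ltac:(lra) Hd).
    pose proof (Rmult_le_pos (1 - t) c ltac:(lra) (Rlt_le _ _ Hc)); lra.
Qed.

(** Only [c <> d] is asked, not [c < d]: the half of [a, b] above the midpoint is
    traversed backwards, with [c = b] and [d = a]. *)
Lemma is_RInt_Rpower_segment (p c d : R) :
  0 < c -> 0 < d -> c <> d -> p + 1 <> 0 ->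
  is_RInt (fun t => Rpower ((1 - t) * d + t * c) p) 0 1
          ((Rpower d (p + 1) - Rpower c (p + 1)) / ((p + 1) * (d - c))).
Proof.
  intros Hc Hd Hcd Hp.
  set (F := fun t => / ((p + 1) * (c - d)) * Rpower ((1 - t) * d + t * c) (p + 1)).
  replace (_ / _) with (minus (F 1) (F 0)).
  - apply (is_RInt_derive F); intros t; rewrite Rmin_left, Rmax_right by lra; intros Ht;
      pose proof (segment_pos d c t Hd Hc Ht) as Hpos.
    + unfold F; evar_last.
      * apply (is_derive_scal (fun t => Rpower ((1 - t) * d + t * c) (p + 1))).
        apply is_derive_Rpower_comp; [exact Hpos |].
        auto_derive; [trivial | reflexivity].
      * simpl; replace (p + 1 - 1) with p by ring; field; lra.
    + apply (ex_derive_continuous (fun t => Rpower ((1 - t) * d + t * c) p)).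
      eexists; apply is_derive_Rpower_comp; [exact Hpos |].
      auto_derive; [trivial | reflexivity].
  - unfold F, minus, plus, opp; simpl.
    replace ((1 - 1) * d + 1 * c) with c by ring.
    replace ((1 - 0) * d + 0 * c) with d by ring.
    field; lra.
Qed.

(** The value of the integral in [is_RInt_half], kept in closed form so that
    [means_eq_half_integrals] is an identity between powers. *)
Definition half_integral (s c d : R) : R :=
  2 / (d - c) * (c * Rpower (arith_mean c d) s - d * Rpower c s
                 + 2 * (Rpower (arith_mean c d) (s + 1) - Rpower c (s + 1)) / (s + 1)).

(** Integration by parts: the weight [(1 - t) d + t c] has derivative [c - d],
    which is minus twice the speed [(d - c) / 2] of the point [x t]; this is the
    source of the factor 2 in front of the antiderivative [x^(s+1) / (s+1)]. *)
Lemma is_RInt_half (s c d : R) :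
  0 < c -> 0 < d -> c <> d -> 0 < s ->
  is_RInt (fun t => ((1 - t) * d + t * c)
                    * (s * Rpower ((1 - t / 2) * c + t / 2 * d) (s - 1)))
          0 1 (half_integral s c d).
Proof.
  intros Hc Hd Hcd Hs.
  set (x := fun t => (1 - t / 2) * c + t / 2 * d).
  set (F := fun t => 2 / (d - c) * (((1 - t) * d + t * c) * Rpower (x t) s
                                    + 2 / (s + 1) * Rpower (x t) (s + 1))).
  assert (Dx : forall t, is_derive x t ((d - c) / 2)).
  { intros t; unfold x; auto_derive; [trivial | field]. }
  replace (half_integral s c d) with (minus (F 1) (F 0)).
  - apply (is_RInt_derive F); intros t; rewrite Rmin_left, Rmax_right by lra; intros Ht;
      assert (Hpos : 0 < x t) by (apply segment_pos; lra).
    + unfold F; evar_last.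
      * apply (is_derive_scal (fun t => _ + _)), (is_derive_plus (fun t => _ * _)).
        -- apply (is_derive_mult (fun t => (1 - t) * d + t * c)).
           ++ auto_derive; [trivial | reflexivity].
           ++ apply is_derive_Rpower_comp; [exact Hpos | apply Dx].
           ++ intros; apply Rmult_comm.
        -- apply (is_derive_scal (fun t => Rpower (x t) (s + 1))).
           apply is_derive_Rpower_comp; [exact Hpos | apply Dx].
      * unfold plus, mult; simpl; unfold mult; simpl.
        replace (s + 1 - 1) with s by ring; fold (x t); field; lra.
    + apply (continuous_mult (fun t => (1 - t) * d + t * c)
                             (fun t => s * Rpower (x t) (s - 1)));
        apply (ex_derive_continuous (V := R_NormedModule)).
      * auto_derive; trivial.
      * eexists; apply (is_derive_scal (fun t => Rpower (x t) (s - 1))).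
        apply is_derive_Rpower_comp; [exact Hpos | apply Dx].
  - unfold F, half_integral, minus, plus, opp; simpl.
    replace (x 1) with (arith_mean c d) by (unfold x, arith_mean; field).
    replace (x 0) with c by (unfold x; field).
    rewrite !Rpower_S.
    field; lra. all: unfold arith_mean; lra.
Qed.

(** * Assembling the estimate *)

Lemma gen_log_mean_sym (r u v : R) : r + 1 <> 0 -> u <> v ->
  gen_log_mean r u v = gen_log_mean r v u.
Proof. intros Hr Huv; unfold gen_log_mean; f_equal; field; lra. Qed.

Lemma gen_log_mean_pow (r u v : R) :
  0 < u -> 0 < v -> u <> v -> r <> 0 -> r + 1 <> 0 ->
  Rpower (gen_log_mean r u v) r
  = (Rpower v (r + 1) - Rpower u (r + 1)) / ((r + 1) * (v - u)).
Proof.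
  intros Hu Hv Huv Hr Hr1; unfold gen_log_mean.
  rewrite Rpower_mult; replace (1 / r * r) with 1 by (field; exact Hr).
  now apply Rpower_1, power_quotient_pos.
Qed.

(** Hölder's inequality applied to the weight and to the derivative [f'], whose
    [q]-th power is bounded by the chord between its values at [c] and [d]. *)
Lemma half_integral_bounds (s p q c d : R) :
  0 < c -> 0 < d -> c <> d -> 0 < s <= 1 -> 0 < p -> 0 < q -> 1 / p + 1 / q = 1 ->
  0 <= half_integral s c d
    <= gen_log_mean p c d
       * Rpower ((Rpower (s * Rpower d (s - 1)) q
                  + (Rpower 2 (s + 1) - 1) * Rpower (s * Rpower c (s - 1)) q)
                 / (Rpower 2 s * (s + 1))) (1 / q).
Proof.
  intros Hc Hd Hcd Hs Hp Hq Hpq.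
  assert (weight_pos : forall t, 0 < t < 1 -> 0 < (1 - t) * d + t * c)
    by (intros; apply segment_pos; lra).
  assert (deriv_pos : forall x, 0 < s * Rpower x (s - 1))
    by (intros; apply Rmult_lt_0_compat; [lra | apply Rpower_pos]).
  pose proof (is_RInt_half s c d Hc Hd Hcd (proj1 Hs)) as int_half.
  split.
  - apply (is_RInt_ge_0 _ 0 1 _ Rle_0_1 int_half).
    intros t Ht; apply Rlt_le, Rmult_lt_0_compat; auto.
  - set (P := Rpower (s * Rpower c (s - 1)) q).
    set (Q := Rpower (s * Rpower d (s - 1)) q).
    assert (HP : 0 < P) by apply Rpower_pos.
    assert (HQ : 0 < Q) by apply Rpower_pos.
    assert (int_majorant :
      is_RInt (fun t => (1 - t / 2) * P + t / 2 * Q) 0 1 (3 / 4 * P + 1 / 4 * Q)).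
    { set (F := fun t => (t - t ^ 2 / 4) * P + t ^ 2 / 4 * Q).
      replace (3 / 4 * P + 1 / 4 * Q) with (minus (F 1) (F 0))
        by (unfold F, minus, plus, opp; simpl; field).
      apply (is_RInt_derive F); intros t _.
      - unfold F; auto_derive; [trivial | field].
      - apply (ex_derive_continuous (fun t => (1 - t / 2) * P + t / 2 * Q)).
        auto_derive; trivial. }
    pose proof (is_RInt_Rpower_segment p c d Hc Hd Hcd ltac:(lra)) as int_weight.
    assert (mean_pos : 0 < (Rpower d (p + 1) - Rpower c (p + 1)) / ((p + 1) * (d - c)))
      by (apply power_quotient_pos; lra).
    eapply Rle_trans.
    + refine (holder_with_majorant _ _ _ 0 1 p q _ _ _ Rle_0_1 Hp Hq Hpq weight_pos _ _
                int_half int_weight int_majorant mean_pos _);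
        [auto | | lra].
      intros t Ht; cbv beta.
      unfold P, Q; rewrite <- !Rpower_mult_distr, !Rpower_mult by (lra || apply Rpower_pos).
      eapply Rle_trans.
      * apply Rmult_le_compat_l; [left; apply Rpower_pos |].
        apply Rpower_neg_convex; try lra.
        pose proof (Rmult_le_pos (1 - s) q); lra.
      * right; ring.
    + unfold gen_log_mean; apply Rmult_le_compat_l; [left; apply Rpower_pos |].
      apply Rle_Rpower_l; [left; apply Rdiv_lt_0_compat; lra |].
      split; [lra | now apply convex_weights_le].
Qed.

(** The first mean contributes the average of [x^s]; the factor [a b] turns the
    second term into [(a b^s - b a^s) / (b - a)], which collects the boundary
    terms at [a] and [b].  At [s = 1] this quotient is 0, in agreement with the
    vanishing factor [s - 1]. *)
Lemma means_eq_half_integrals (a b s : R) :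
  0 < a -> a < b -> 0 < s <= 1 ->
  Rpower (gen_log_mean s a b) s
  + ((s - 1) * geom_mean a b ^ 2 * Rpower (gen_log_mean (s - 2) a b) (s - 2)
     - Rpower (arith_mean a b) s) / 2
  = / 4 * (half_integral s a b + half_integral s b a).
Proof.
  intros Ha Hab Hs.
  assert (HL : Rpower (gen_log_mean s a b) s
               = (Rpower b (s + 1) - Rpower a (s + 1)) / ((s + 1) * (b - a))).
  { apply gen_log_mean_pow; lra. }
  assert (HG : (s - 1) * geom_mean a b ^ 2 * Rpower (gen_log_mean (s - 2) a b) (s - 2)
               = (a * Rpower b s - b * Rpower a s) / (b - a)).
  { assert (Hpred : forall x, 0 < x -> Rpower x s = Rpower x (s - 1) * x).
    { intros x Hx; rewrite <- Rpower_S by assumption; f_equal; ring. }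
    rewrite !Hpred by lra.
    destruct (Req_dec s 1) as [-> | Hs1].
    - replace (1 - 1) with 0 by ring; rewrite !Rpower_O by lra; field; lra.
    - unfold geom_mean; rewrite pow2_sqrt by (apply Rmult_le_pos; lra).
      rewrite gen_log_mean_pow by lra.
      replace (s - 2 + 1) with (s - 1) by ring; field; lra. }
  rewrite HL, HG; unfold half_integral.
  replace (arith_mean b a) with (arith_mean a b) by (unfold arith_mean; lra).
  field; lra.
Qed.

(* For s = 1 the mean [gen_log_mean (s - 2) a b] takes a default value, but its
   factor s - 1 is 0, so the whole term is 0 as intended. *)
Theorem proposition3 (a b s p q : R)
  (ha : 0 < a) (hab : a < b)
  (hs0 : 0 < s) (hs1 : s <= 1)
  (hq : 1 < q) (hpq : 1 / p + 1 / q = 1) :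
  Rabs (Rpower (gen_log_mean s a b) s
        + ((s - 1) * geom_mean a b ^ 2 * Rpower (gen_log_mean (s - 2) a b) (s - 2)
           - Rpower (arith_mean a b) s) / 2)
  <= gen_log_mean p a b / Rpower (Rpower 2 (2 * q + s) * (s + 1)) (1 / q)
     * (Rpower (Rpower (s * Rpower b (s - 1)) q
                + (Rpower 2 (s + 1) - 1) * Rpower (s * Rpower a (s - 1)) q) (1 / q)
        + Rpower (Rpower (s * Rpower a (s - 1)) q
                  + (Rpower 2 (s + 1) - 1) * Rpower (s * Rpower b (s - 1)) q) (1 / q)).
Proof.
  assert (hp : 0 < p).
  { assert (/ q < 1) by (rewrite <- Rinv_1; apply Rinv_lt_contravar; lra).
    rewrite <- (Rinv_inv p); apply Rinv_0_lt_compat; lra. }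
  rewrite means_eq_half_integrals by lra.
  destruct (half_integral_bounds s p q a b) as [La Ua]; try lra.
  destruct (half_integral_bounds s p q b a) as [Lb Ub]; try lra.
  rewrite (gen_log_mean_sym p b a) in Ub by lra.
  rewrite Rabs_pos_eq by lra.
  set (P := Rpower (s * Rpower a (s - 1)) q) in *.
  set (Q := Rpower (s * Rpower b (s - 1)) q) in *.
  assert (HP : 0 < P) by apply Rpower_pos.
  assert (HQ : 0 < Q) by apply Rpower_pos.
  set (D := Rpower 2 s * (s + 1)) in *.
  assert (HD : 0 < D) by (apply Rmult_lt_0_compat; [apply Rpower_pos | lra]).
  assert (split_const : Rpower (Rpower 2 (2 * q + s) * (s + 1)) (1 / q)
                        = 4 * Rpower D (1 / q)).
  { rewrite Rpower_plus, Rmult_assoc; fold D.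
    rewrite <- Rpower_mult_distr, Rpower_mult by (assumption || apply Rpower_pos).
    replace (2 * q * (1 / q)) with (1 + 1) by (field; lra).
    rewrite Rpower_plus, Rpower_1 by lra; ring. }
  assert (quot : forall x, 0 < x ->
            Rpower (x / D) (1 / q) = Rpower x (1 / q) / Rpower D (1 / q)).
  { intros x Hx; unfold Rdiv at 1.
    rewrite <- Rpower_mult_distr by (assumption || now apply Rinv_0_lt_compat).
    unfold Rdiv at 3; f_equal; unfold Rpower.
    rewrite ln_Rinv, Ropp_mult_distr_r_reverse by assumption; apply exp_Ropp. }
  assert (K : 0 < Rpower 2 (s + 1) - 1).
  { apply Rlt_0_minus; apply Rle_lt_trans with (Rpower 2 0);
      [rewrite Rpower_O | apply Rpower_lt]; lra. }
  pose proof (Rmult_lt_0_compat _ _ K HP); pose proof (Rmult_lt_0_compat _ _ K HQ).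
  rewrite quot in Ua by lra; rewrite quot in Ub by lra.
  rewrite split_const.
  pose proof (Rpower_pos D (1 / q)).
  eapply Rle_trans; [apply Rmult_le_compat_l; [lra | apply Rplus_le_compat; [exact Ua | exact Ub]] |].
  right; field; lra.
Qed.
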